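(* Let $m = 2q$, where $q = q_1 \cdots q_n$ is a product of distinct primes $q_j$ with each $q_j \equiv 1$ or $3 \pmod 8$, and $q \equiv 3 \pmod 8$. Then over the real quadratic field $K=\mathbb{Q}(\sqrt{m})$ there exists an elliptic curve $E/K$ with everywhere good reduction; moreover such an $E$ can be chosen with $j(E) = 20^3$.
   Context: An elliptic curve $E/K$ has everywhere good reduction if it has good reduction at every prime of $\mathcal{O}_K$. *)

(* Defs.v *)
From HB Require Import structures.
From mathcomp Require Import all_boot all_order all_algebra all_field.
Set Implicit Arguments. Unset Strict Implicit. Unset Printing Implicit Defensive.
Import Order.TTheory GRing.Theory Num.Theory.
Local Open Scope ring_scope.

Definition inK (m : nat) (x : algC) : Prop :=
  exists a b : rat, x = ratr a + ratr b * sqrtC (m%:R).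

Definition inOK (m : nat) (x : algC) : Prop := inK m x /\ x \in Aint.

Definition prime_ideal_OK (m : nat) (P : algC -> Prop) : Prop :=
  [/\ (forall x, P x -> inOK m x),
      P 0,
      (forall x y, P x -> P y -> P (x + y)),
      (forall r x, inOK m r -> P x -> P (r * x))
    & [/\ ~ P 1,
           (forall x y, inOK m x -> inOK m y -> P (x * y) -> P x \/ P y)
         & exists x, P x /\ x <> 0]].

Definition P_integral (m : nat) (P : algC -> Prop) (x : algC) : Prop :=
  exists a s, [/\ inOK m a, inOK m s, ~ P s & s * x = a].

Definition P_unit (m : nat) (P : algC -> Prop) (x : algC) : Prop :=
  x <> 0 /\ P_integral m P x /\ P_integral m P x^-1.

(* Weierstrass equation y^2 + a1 xy + a3 y = x^3 + a2 x^2 + a4 x + a6 *)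
Record weq := Weq { a1 : algC; a2 : algC; a3 : algC; a4 : algC; a6 : algC }.

Definition b2 E := a1 E ^+ 2 + 4%:R * a2 E.
Definition b4 E := 2%:R * a4 E + a1 E * a3 E.
Definition b6 E := a3 E ^+ 2 + 4%:R * a6 E.
Definition b8 E := a1 E ^+ 2 * a6 E + 4%:R * a2 E * a6 E - a1 E * a3 E * a4 E
                   + a2 E * a3 E ^+ 2 - a4 E ^+ 2.
Definition c4 E := b2 E ^+ 2 - 24%:R * b4 E.
Definition disc E := - b2 E ^+ 2 * b8 E - 8%:R * b4 E ^+ 3 - 27%:R * b6 E ^+ 2
                     + 9%:R * b2 E * b4 E * b6 E.
Definition jinv E := c4 E ^+ 3 / disc E.

Definition coeffs_in (Q : algC -> Prop) E :=
  [/\ Q (a1 E), Q (a2 E), Q (a3 E), Q (a4 E) & Q (a6 E)].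

Definition elliptic_over (m : nat) E := coeffs_in (inK m) E /\ disc E <> 0.

(* E' is obtained from E by the change of variables
   x = u^2 x' + r, y = u^3 y' + s u^2 x' + t with u,r,s,t in K, u <> 0 *)
Definition K_isomorphic (m : nat) E E' : Prop :=
  exists u r s t, [/\ [/\ inK m u, inK m r, inK m s & inK m t], u <> 0 &
   [/\ u * a1 E' = a1 E + 2%:R * s,
       u ^+ 2 * a2 E' = a2 E - s * a1 E + 3%:R * r - s ^+ 2,
       u ^+ 3 * a3 E' = a3 E + r * a1 E + 2%:R * t,
       u ^+ 4 * a4 E' = a4 E - s * a3 E + 2%:R * r * a2 E - (t + r * s) * a1 E
                        + 3%:R * r ^+ 2 - 2%:R * s * t
     & u ^+ 6 * a6 E' = a6 E + r * a4 E + r ^+ 2 * a2 E + r ^+ 3 - t * a3 E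
                        - t ^+ 2 - r * t * a1 E]].

Definition good_reduction_at (m : nat) (P : algC -> Prop) E : Prop :=
  exists E', [/\ K_isomorphic m E E', coeffs_in (inK m) E',
                 coeffs_in (P_integral m P) E' & P_unit m P (disc E')].

Definition everywhere_good (m : nat) E : Prop :=
  forall P, prime_ideal_OK m P -> good_reduction_at m P E.

(* Main.v *)
(* Quadratic twists of [y^2 = x^3 + 4 x^2 + 2 x], which has CM by Z[sqrt(-2)],
   all have j = 20^3.  Since -2 is a square modulo every prime factor of [q],
   one can write [q = b^2 + 2 a^2] with [a], [b] odd and coprime, and choose the
   sign so that [a = 3] modulo 4.  Put [d = 2 a + sqrt m]; then
   [d d' = - 2 b^2] for the conjugate [d'], and an odd prime cannot contain both
   [d] and [d'], so away from 2 the element [d] is locally a unit times a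
   square ([1] or [b^2]).  At 2 an explicit change of variables exhibits a model
   with discriminant [(d^2 / 2)^3], where [d^2 / 2] is a unit because its norm
   [b^4] is odd. *)
Require Import Defs.
From Stdlib Require Import Classical_Prop.
From HB Require Import structures.
From mathcomp Require Import all_boot all_order all_algebra all_fingroup all_solvable all_field.
From mathcomp Require Import zify ring.
Set Implicit Arguments. Unset Strict Implicit. Unset Printing Implicit Defensive.
Import Order.TTheory GRing.Theory Num.Theory.
Local Open Scope ring_scope.

(** * Square roots of -2 modulo a prime *)

(** The nonzero elements are [#|F|.-1] distinct roots of unity of that order, and a field containing
    that many has a primitive one among them. *)
Lemma finField_prim_root (F : finFieldType) :
  exists z : F, (#|F|.-1).-primitive_root z.
Proof.
have F1 : (1 < #|F|)%N by apply: finNzRing_gt1.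
have: has (#|F|.-1).-primitive_root [seq x <- enum F | x != 0].
  apply: has_prim_root; first by case: #|F| F1 => [|[]].
  - apply/allP=> x; rewrite mem_filter => /andP[x0 _].
    rewrite unity_rootE -subr_eq0 -(inj_eq (mulfI x0)) mulr0 mulrBr mulr1 -exprS.
    by rewrite prednK ?(ltnW F1) // expf_card subrr.
  - by rewrite filter_uniq ?enum_uniq.
  - have -> : [seq x <- enum F | x != 0] = rem 0 (enum F).
      by rewrite rem_filter ?enum_uniq.
    by rewrite size_rem ?mem_enum // cardE.
by case/hasP=> z _ zP; exists z.
Qed.

(** The images of the naturals below [p] are already [p] distinct roots of X^p - X; any other fixed
    point of the Frobenius would be one root too many. *)
Lemma pchar_prime_subfield (F : fieldType) p (w : F) :
  p \in [pchar F] -> w ^+ p = w -> exists n : nat, w = n%:R.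
Proof.
move=> pF wp; have p_pr := pcharf_prime pF.
pose s := [seq n%:R : F | n <- iota 0 p].
case: (boolP (w \in s)) => [/mapP[n _ ->]|ws]; first by exists n.
have sz : size ('X^p - 'X : {poly F}) = p.+1.
  by rewrite size_polyDl size_polyXn // size_polyN size_polyX ltnS prime_gt1.
have := @max_poly_roots F ('X^p - 'X) (w :: s).
rewrite sz /= size_map size_iota ltnn -size_poly_eq0 sz ws /= => H.
have /H : true by [].
rewrite /root !hornerE wp subrr eqxx /= => {}H.
have /H : all (root ('X^p - 'X)) s.
  apply/allP=> _ /mapP[n _ ->].
  by rewrite /root !hornerE -(pFrobenius_autE pF) pFrobenius_aut_nat subrr.
suff -> : uniq s by move/(_ isT).
rewrite map_inj_in_uniq ?iota_uniq // => i j.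
rewrite !mem_iota /= !add0n => ip jp.
wlog ij : i j ip jp / (i <= j)%N.
  by move=> W; case: (leqP i j) => [|/ltnW] h e; [|symmetry]; apply: W.
move/eqP; rewrite eq_sym -subr_eq0 -natrB // -(dvdn_pcharf pF).
case: (posnP (j - i)) => [|h /(dvdn_leq h)]; lia.
Qed.

(* [-2 = (z + z^3)^2] for [z] a primitive 8th root of unity, and the
    Frobenius fixes [z + z^3] because [p] is 1 or 3 mod 8. *)
Lemma sqrt_neg2_modp p : prime p -> (p %% 8 == 1)%N || (p %% 8 == 3)%N ->
  exists n : nat, (p %| n ^ 2 + 2)%N.
Proof.
(* The field with p^2 elements contains the 8th roots of unity, since 8 divides p^2 - 1. *)
move=> p_pr p8; have [F pF cF] := pPrimePowerField p_pr (isT : 0 < 2)%N.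
have [x xP] := finField_prim_root F; rewrite cF in xP.
have d8 : (8 %| (p ^ 2).-1)%N.
  have [k ->] : exists k, (p ^ 2 = k * 8 + (p %% 8) ^ 2)%N.
    exists (p %/ 8 * p + p %% 8 * (p %/ 8))%N.
    by move: (p %/ 8)%N (p %% 8)%N (divn_eq p 8) => a b ->; lia.
  by apply/dvdnP; case/orP: p8 => /eqP ->; [exists k | exists k.+1]; lia.
have [z zP] : exists z : F, 8.-primitive_root z by exists (x ^+ ((p ^ 2).-1 %/ 8)); exact: dvdn_prim_root.
have z4 : z ^+ 4 = -1.
  have := prim_expr_order zP; rewrite -[8%N]/(4 * 2)%N exprM => /eqP.
  by rewrite sqrf_eq1 -(prim_order_dvd zP) => /= /eqP.
pose w := z + z ^+ 3.
have w2 : w ^+ 2 = - 2%:R.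
  have -> : w ^+ 2 = z ^+ 2 * (1 + z ^+ 4) + 2%:R * z ^+ 4 by rewrite /w; ring.
  by rewrite z4; ring.
have wp : w ^+ p = w.
  rewrite -(pFrobenius_autE pF) rmorphD rmorphXn /= pFrobenius_autE.
  rewrite -(prim_expr_mod zP p).
  (* For [p] = 1 mod 8 the Frobenius fixes [z]; for [p] = 3 mod 8 it exchanges [z] and z^3, as z^9 =
     z. *)
  case/orP: p8 => /eqP ->; rewrite /w ?expr1 // -exprM.
  by rewrite -(prim_expr_mod zP (3 * 3)) /= addrC.
have [n wn] := pchar_prime_subfield pF wp.
by exists n; rewrite (dvdn_pcharf pF) natrD natrX -wn w2 addNr.
Qed.

(** * Representation by the form x^2 + 2 y^2 *)

Lemma int_parity (x : int) : exists z, x = 2 * z \/ x = 2 * z + 1.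
Proof. by exists (x %/ 2)%Z; lia. Qed.

(** Necessarily [x] is even, and x = 2 z gives n = y^2 + 2 z^2. *)
Lemma halve_sq2sq (n x y : int) : x ^+ 2 + 2 * y ^+ 2 = 2 * n ->
  exists u v : int, n = u ^+ 2 + 2 * v ^+ 2.
Proof. by have [z [->|->]] := int_parity x => h; [exists y, z; lia | lia]. Qed.

(* Thue: by pigeonhole [x = - n y] mod [p] with [x^2, y^2 < p], hence [x^2 + 2 y^2] is [p] or [2 p]. *)
Lemma prime_eq_sq2sq p : prime p -> (p %% 8 == 1)%N || (p %% 8 == 3)%N ->
  exists x y : int, p%:Z = x ^+ 2 + 2 * y ^+ 2.
Proof.
move=> p_pr p8; have [n pn] := sqrt_neg2_modp p_pr p8.
have p_gt1 := prime_gt1 p_pr.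
have [s sp ps] : exists2 s, (s ^ 2 <= p)%N & (p < s.+1 ^ 2)%N.
  have [|s sp sm] := @ex_maxnP (fun s => s ^ 2 <= p)%N p (ex_intro _ 0%N isT).
    by move=> i; apply: leq_trans; case: i => // i; rewrite -{1}(expn1 i.+1) leq_pexp2l.
  by exists s => //; rewrite ltnNge; apply/negP => /sm; rewrite ltnn.
(* A prime is not a square. The strict inequality gives x^2 + 2 y^2 <= 3 s^2 < 3 p below, which
   leaves only the multiples [p] and 2 p. *)
have {}sp : (s ^ 2 < p)%N.
  rewrite ltn_neqAle sp andbT; apply/eqP=> e.
  have : (p %| s ^ 2)%N by rewrite e.
  rewrite Euclid_dvdX // andbT; case: s e {sp ps} => [|[|s]] e; [lia | lia |].
  by move/(dvdn_leq (ltn0Sn _)); rewrite -e -mulnn leqNgt ltn_Pmull.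
pose f (u : 'I_s.+1 * 'I_s.+1) : 'I_p := Ordinal (ltn_pmod (u.1 + n * u.2) (ltnW p_gt1)).
have /injectivePn[u [v uv fuv]] : ~~ injectiveb f.
  by apply/negP=> /injectiveP /leq_card; rewrite card_prod !card_ord; lia.
have : (u.1 + n * u.2 = v.1 + n * v.2 %[mod p])%N by case: fuv.
have : (u.1 != v.1 :> nat) || (u.2 != v.2 :> nat).
  by move: uv; case: (u) (v) => [u1 u2] [v1 v2]; rewrite -negb_and.
move: (ltn_ord u.1) (ltn_ord u.2) (ltn_ord v.1) (ltn_ord v.2).
move: (u.1 : nat) (u.2 : nat) (v.1 : nat) (v.2 : nat) => {f u v uv fuv} u1 u2 v1 v2.
move=> u1s u2s v1s v2s uv /(congr1 Posz); rewrite -!modz_nat => /eqP; rewrite eqz_mod_dvd => /dvdzP[k uvk].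
have [l nl] := dvdnP pn.
pose x := u1%:Z - v1%:Z; pose y := u2%:Z - v2%:Z.
have x2 : x ^+ 2 <= s%:Z ^+ 2 by rewrite -[leLHS]real_normK ?num_real // lerXn2r ?nnegrE // /x; lia.
have y2 : y ^+ 2 <= s%:Z ^+ 2 by rewrite -[leLHS]real_normK ?num_real // lerXn2r ?nnegrE // /y; lia.
have xy0 : 0 < x ^+ 2 + 2 * y ^+ 2.
  have : (x ^+ 2 != 0) || (y ^+ 2 != 0) by rewrite !sqrf_eq0 /x /y; lia.
  by move: (x ^+ 2) (y ^+ 2) (sqr_ge0 x) (sqr_ge0 y) => {x2 y2 uvk uv} X Y; lia.
have xny : x + n%:Z * y = k * p%:Z by rewrite /x /y -uvk !PoszD !PoszM; ring.
have [c xyp] : exists c, x ^+ 2 + 2 * y ^+ 2 = c * p%:Z.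
  exists (k * (x - n%:Z * y) + l%:Z * y ^+ 2).
  have nl' : n%:Z ^+ 2 + 2 = l%:Z * p%:Z by rewrite -PoszM -nl PoszD -mulnn PoszM.
  transitivity ((x + n%:Z * y) * (x - n%:Z * y) + (n%:Z ^+ 2 + 2) * y ^+ 2); first by ring.
  by rewrite xny nl'; ring.
have sp' : s%:Z ^+ 2 < p%:Z by lia.
have [c1 | c2] : c = 1 \/ c = 2.
  suff : 0 < c < 3 by lia.
  have p0 : 0 < p%:Z by rewrite ltz_nat prime_gt0.
  move: xy0; rewrite xyp pmulr_lgt0 // => -> /=; rewrite -(ltr_pM2r p0) -xyp.
  by move: {xyp xny uvk uv} (x ^+ 2) (y ^+ 2) (s%:Z ^+ 2) x2 y2 sp' => X Y S; lia.
- by exists x, y; rewrite xyp c1 mul1r.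
- by apply: (@halve_sq2sq p%:Z x y); rewrite xyp c2.
Qed.

Lemma prod_eq_sq2sq (ps : seq nat) :
  (forall p, p \in ps -> exists x y : int, p%:Z = x ^+ 2 + 2 * y ^+ 2) ->
  exists x y : int, (\prod_(p <- ps) p)%N%:Z = x ^+ 2 + 2 * y ^+ 2.
Proof.
elim: ps => [_|p ps IH H]; first by exists 1, 0; rewrite big_nil.
have [p' hp|x [y xy]] := IH; first by apply: H; rewrite inE hp orbT.
have [u [v uv]] := H p (mem_head p ps).
(* The form is the norm from Z[sqrt(-2)]; these are the coordinates of the product of u + v sqrt(-2)
   and x + y sqrt(-2). *)
exists (u * x - 2 * v * y), (u * y + v * x).
by rewrite big_cons PoszM uv xy; ring.
Qed.

(** A prime dividing the product occurs in the list; if its square divides, it also occurs among the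
    remaining factors, against [uniq]. *)
Lemma prod_primes_squarefree (ps : seq nat) l :
  uniq ps -> all prime ps -> prime l -> ~~ (l ^ 2 %| \prod_(p <- ps) p)%N.
Proof.
move=> ups pps pl; apply/negP=> l2.
have dvd_mem (rs : seq nat) : all prime rs -> (l %| \prod_(p <- rs) p)%N -> l \in rs.
  move/allP=> prs; rewrite Euclid_dvd_prod // big_has => /hasP[p prs' lp].
  by rewrite (eqP (_ : l == p)) // -dvdn_prime2 // prs.
have lps : l \in ps by apply: dvd_mem => //; apply: dvdn_trans l2; exact: dvdn_exp.
move: l2; rewrite (big_rem l lps) /= -mulnn dvdn_pmul2l ?prime_gt0 //.
move/dvd_mem; rewrite mem_rem_uniq // inE eqxx => H.
by have /H : all prime (rem l ps) by apply/allP=> p /mem_rem; apply: (allP pps).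
Qed.

(** A common prime factor of [x] and [y] would have its square dividing the squarefree product.
    Modulo 8, the value 3 forces both to be odd: even [x] gives an even value, and odd [x] with even
    [y] gives 1. *)
Lemma prod_eq_sq2sq_normalized (qs : seq nat) :
  uniq qs -> all prime qs ->
  all (fun p => (p %% 8 == 1)%N || (p %% 8 == 3)%N) qs ->
  ((\prod_(p <- qs) p) %% 8 = 3)%N ->
  exists k l u v : int, let a := 4 * k + 3 in let b := 2 * l + 1 in
    (\prod_(p <- qs) p)%N%:Z = b ^+ 2 + 2 * a ^+ 2 /\ u * a + v * b = 1.
Proof.
move=> uqs pqs qs8 q8.
have [x [y qxy]] : exists x y : int, (\prod_(p <- qs) p)%N%:Z = x ^+ 2 + 2 * y ^+ 2.
  by apply: prod_eq_sq2sq => p pq; apply: prime_eq_sq2sq; [apply: (allP pqs) | apply: (allP qs8)].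
have /coprimezP[[u v] /= uv] : coprimez y x.
  rewrite coprimezE /coprime; set g := gcdn _ _; apply/negPn/negP=> g1.
  have g0 : (0 < g)%N.
    rewrite gcdn_gt0 !absz_gt0 -negb_and; apply/negP=> /andP[/eqP y0 /eqP x0].
    by move: q8; case: qxy; rewrite x0 y0 => /eqP; rewrite eqz_nat => /eqP->.
  have l_pr : prime (pdiv g) by apply: pdiv_prime; rewrite ltn_neqAle eq_sym g1.
  have /dvdzP[y' yl] : ((pdiv g)%:Z %| y)%Z by apply: dvdn_trans (pdiv_dvd g) (dvdn_gcdl _ _).
  have /dvdzP[x' xl] : ((pdiv g)%:Z %| x)%Z by apply: dvdn_trans (pdiv_dvd g) (dvdn_gcdr _ _).
  have /negP[] := prod_primes_squarefree uqs pqs l_pr.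
  change (`|(pdiv g ^ 2)%N%:Z| %| `|(\prod_(p <- qs) p)%N%:Z|)%N; rewrite -/(dvdz _ _) qxy.
  by apply/dvdzP; exists (x' ^+ 2 + 2 * y' ^+ 2); rewrite {1}xl {1}yl; lia.
move: {uqs pqs qs8} (\prod_(p <- qs) p)%N qxy q8 => q qxy q8.
have [l [xl | xl]] := int_parity x; first by move: q8 qxy; rewrite xl; lia.
have [h [yh | yh]] := int_parity y; first by move: (int_parity l) q8 qxy => [l' [l'h|l'h]]; rewrite xl yh l'h; lia.
have [k [hk | hk]] := int_parity h.
(* Here y = 4 k + 1, so -y = 4 (-k - 1) + 3 is taken instead, and the Bezout coefficient [u] changes
   sign with it. *)
- exists (- k - 1), l, (- u), v; split; first by rewrite qxy xl yh hk; ring.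
  by rewrite -[RHS]uv xl yh hk; ring.
- exists k, l, u, v; split; first by rewrite qxy xl yh hk; ring.
  by rewrite -[RHS]uv xl yh hk; ring.
Qed.

(** * The field Q(sqrt m), its integers, and integrality at a prime ideal *)

Section QuadraticField.
Variable m : nat.
Let pi : algC := sqrtC m%:R.

Lemma sqr_sqrtC_nat : pi ^+ 2 = m%:R. Proof. exact: sqrtCK. Qed.

Lemma inK_ratr (c : rat) : inK m (ratr c).
Proof. by exists c, 0; rewrite rmorph0 mul0r addr0. Qed.

Lemma inK_int (n : int) : inK m n%:~R.
Proof. by rewrite -(ratr_int algC); apply: inK_ratr. Qed.

Lemma inK_nat (n : nat) : inK m n%:R.
Proof. exact: (inK_int n). Qed.

Lemma inK_sqrt : inK m pi.
Proof. by exists 0, 1; rewrite rmorph0 rmorph1 add0r mul1r. Qed.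

Lemma inKD x y : inK m x -> inK m y -> inK m (x + y).
Proof.
move=> [a [b ->]] [c [d ->]]; exists (a + c), (b + d).
by rewrite !rmorphD /=; ring.
Qed.

Lemma inKN x : inK m x -> inK m (- x).
Proof. by move=> [a [b ->]]; exists (- a), (- b); rewrite !rmorphN /=; ring. Qed.

Lemma inKM x y : inK m x -> inK m y -> inK m (x * y).
Proof.
move=> [a [b ->]] [c [d ->]]; exists (a * c + b * d * m%:R), (a * d + b * c).
rewrite -/pi !rmorphD !rmorphM /= ratr_nat -sqr_sqrtC_nat; ring.
Qed.

Lemma inKX x n : inK m x -> inK m (x ^+ n).
Proof.
move=> Kx; elim: n => [|n IH]; first by rewrite expr0; apply: (inK_nat 1).
by rewrite exprS; apply: inKM.
Qed.

Lemma inK_intV (n : int) : inK m n%:~R^-1.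
Proof. by rewrite -(ratr_int algC) -fmorphV; apply: inK_ratr. Qed.

Lemma inOK_int (n : int) : inOK m n%:~R.
Proof. by split; [apply: inK_int | apply: Aint_int]. Qed.

Lemma inOK_nat (n : nat) : inOK m n%:R.
Proof. exact: (inOK_int n). Qed.

Lemma inOK_sqrt : inOK m pi.
Proof.
split; first exact: inK_sqrt.
apply: (@root_monic_Aint ('X^2 - m%:R%:P)).
- by rewrite /root !hornerE sqr_sqrtC_nat subrr.
- by apply: monicXnsubC.
- apply/polyOverP=> i; rewrite coefB coefXn coefC.
  by case: (i == 0)%N; rewrite rpredB ?rpred_nat ?rpred0.
Qed.

Lemma inOKD x y : inOK m x -> inOK m y -> inOK m (x + y).
Proof. by move=> [Kx Ax] [Ky Ay]; split; [apply: inKD | apply: rpredD]. Qed.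

Lemma inOKN x : inOK m x -> inOK m (- x).
Proof. by move=> [Kx Ax]; split; [apply: inKN | rewrite rpredN]. Qed.

Lemma inOKM x y : inOK m x -> inOK m y -> inOK m (x * y).
Proof. by move=> [Kx Ax] [Ky Ay]; split; [apply: inKM | apply: rpredM]. Qed.

Lemma inOKX x n : inOK m x -> inOK m (x ^+ n).
Proof. by move=> [Kx Ax]; split; [apply: inKX | apply: rpredX]. Qed.

Section PrimeIdeal.
Variable P : algC -> Prop.
Hypothesis Pprime : prime_ideal_OK m P.

Lemma prime_ideal_not1 : ~ P 1.
Proof. by case: Pprime => _ _ _ _ []. Qed.

Lemma prime_idealM x y : inOK m x -> inOK m y -> P (x * y) -> P x \/ P y.
Proof. by case: Pprime => _ _ _ _ [_ H _]; apply: H. Qed.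

Lemma prime_ideal_notM x y : inOK m x -> inOK m y -> ~ P x -> ~ P y -> ~ P (x * y).
Proof. by move=> Ox Oy Nx Ny /prime_idealM[]. Qed.

Lemma prime_ideal_notX x n : inOK m x -> ~ P x -> ~ P (x ^+ n).
Proof.
move=> Ox Nx; elim: n => [|n IH]; first by rewrite expr0; apply: prime_ideal_not1.
by rewrite exprS; apply: prime_ideal_notM => //; apply: inOKX.
Qed.

Lemma P_integral_OK x : inOK m x -> P_integral m P x.
Proof.
by move=> Ox; exists x, 1; split=> //; [apply: (inOK_nat 1) | apply: prime_ideal_not1 | rewrite mul1r].
Qed.

Lemma P_integral_div x s : inOK m x -> inOK m s -> ~ P s -> P_integral m P (x / s).
Proof.
move=> Ox Os Ns; exists x, s; split=> //; rewrite mulrCA divff ?mulr1 //.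
by apply/eqP=> s0; apply: Ns; rewrite s0; case: Pprime.
Qed.

Lemma P_integralV s : inOK m s -> ~ P s -> P_integral m P s^-1.
Proof. by move=> Os Ns; rewrite -div1r; apply: P_integral_div => //; apply: (inOK_nat 1). Qed.

Lemma P_unit_OK s : inOK m s -> ~ P s -> P_unit m P s.
Proof.
move=> Os Ns; split; first by move=> s0; apply: Ns; rewrite s0; case: Pprime.
by split; [apply: P_integral_OK | apply: P_integralV].
Qed.

Lemma prime_ideal_odd (n : int) : P 2%:R -> ~ P (2 * n + 1)%:~R.
Proof.
move=> P2 Pn; apply: prime_ideal_not1.
case: Pprime => _ _ PD PM _.
have -> : 1 = (2 * n + 1)%:~R + (- n)%:~R * 2%:R :> algC by rewrite !rmorphD rmorphM rmorphN /=; ring.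
by apply: PD => //; apply: PM => //; apply: inOK_int.
Qed.

End PrimeIdeal.
End QuadraticField.

(** * The CM curve, its twists and changes of variables *)

(** Multiplying d y^2 = x^3 + 4 x^2 + 2 x by d^3 and absorbing the powers into d x and d^2 y gives
    this model, integral whenever [d] is. *)
Definition cm8_twist (d : algC) : weq := Weq 0 (4%:R * d) 0 (2%:R * d ^+ 2) 0.

Lemma disc_cm8_twist d : disc (cm8_twist d) = 2%:R ^+ 9 * d ^+ 6.
Proof. by rewrite /disc /b2 /b4 /b6 /b8 /=; ring. Qed.

(** Here [c4] is 160 d^2, so the powers of [d] cancel and 160^3 / 2^9 = 20^3 remains. *)
Lemma jinv_cm8_twist d : d <> 0 -> jinv (cm8_twist d) = 20%:R ^+ 3.
Proof.
move=> /eqP d0; rewrite /jinv disc_cm8_twist /c4 /b2 /b4 /=.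
by field.
Qed.

Lemma K_isomorphic_scale m E (w : algC) : inK m w -> w <> 0 ->
  K_isomorphic m E (Weq (a1 E / w) (a2 E / w ^+ 2) (a3 E / w ^+ 3) (a4 E / w ^+ 4) (a6 E / w ^+ 6)).
Proof.
move=> Kw /eqP w0; exists w, 0, 0, 0; split; first by split=> //; apply: (inK_nat m 0).
  exact/eqP.
by split; rewrite /= mulrC divfK ?expf_neq0 //; ring.
Qed.

(** The equations of [K_isomorphic] with the parameters exposed and freed from conditions on them,
    so that the effect on [disc] is a polynomial identity. *)
Definition weq_change (w r s t : algC) E E' : Prop :=
  [/\ w * a1 E' = a1 E + 2%:R * s,
      w ^+ 2 * a2 E' = a2 E - s * a1 E + 3%:R * r - s ^+ 2,
      w ^+ 3 * a3 E' = a3 E + r * a1 E + 2%:R * t,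
      w ^+ 4 * a4 E' = a4 E - s * a3 E + 2%:R * r * a2 E - (t + r * s) * a1 E
                       + 3%:R * r ^+ 2 - 2%:R * s * t
    & w ^+ 6 * a6 E' = a6 E + r * a4 E + r ^+ 2 * a2 E + r ^+ 3 - t * a3 E
                       - t ^+ 2 - r * t * a1 E].

(** The discriminant is homogeneous of weight 12 in the coefficients, which settles [w], and is
    invariant under the substitutions by [r], [s] and [t]. *)
Lemma disc_change w r s t E E' : weq_change w r s t E E' -> w ^+ 12 * disc E' = disc E.
Proof.
case=> h1 h2 h3 h4 h6.
have -> : w ^+ 12 * disc E' =
    disc (Weq (w * a1 E') (w ^+ 2 * a2 E') (w ^+ 3 * a3 E') (w ^+ 4 * a4 E') (w ^+ 6 * a6 E')).
  by rewrite /disc /b2 /b4 /b6 /b8 /=; ring.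
by rewrite h1 h2 h3 h4 h6 /disc /b2 /b4 /b6 /b8 /=; ring.
Qed.

(** * Good reduction of the chosen twist at every prime *)

Section GoodTwist.
Variables (m : nat) (k l u v : int).
Let a : int := 4 * k + 3.
Let b : int := 2 * l + 1.
Hypothesis m_eq : m%:Z = 2 * (b ^+ 2 + 2 * a ^+ 2).
Hypothesis uv : u * a + v * b = 1.
Let pi : algC := sqrtC m%:R.
Let d : algC := 2%:R * a%:~R + pi.
Let d' : algC := 2%:R * a%:~R - pi.

Lemma sqr_pi : pi ^+ 2 = 2%:R * (b%:~R ^+ 2 + 2%:R * a%:~R ^+ 2).
Proof. by rewrite sqr_sqrtC_nat -[m%:R]/(m%:Z%:~R) m_eq !(rmorphM, rmorphD, rmorphXn). Qed.

Lemma twist_norm : d * d' = - 2%:R * b%:~R ^+ 2.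
Proof.
have -> : d * d' = 4%:R * a%:~R ^+ 2 - pi ^+ 2 by rewrite /d /d'; ring.
by rewrite sqr_pi; ring.
Qed.

Lemma b_neq0 : b%:~R != 0 :> algC.
Proof.
(* [clear] stops [lia] from making the lemma depend on the section hypothesis [uv]. *)
by rewrite intr_eq0 /b; clear; lia.
Qed.

Lemma d_neq0 : d != 0.
Proof.
apply/eqP=> d0; have /eqP := twist_norm.
rewrite d0 mul0r eq_sym mulf_eq0 oppr_eq0 pnatr_eq0 /= sqrf_eq0.
exact/negP/b_neq0.
Qed.

Lemma d'_neq0 : d' != 0.
Proof.
apply/eqP=> d0; have /eqP := twist_norm.
rewrite d0 mulr0 eq_sym mulf_eq0 oppr_eq0 pnatr_eq0 /= sqrf_eq0.
exact/negP/b_neq0.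
Qed.

Lemma twist_OK : inOK m d /\ inOK m d'.
Proof.
have Oa : inOK m (2%:R * a%:~R) by apply: inOKM; [apply: inOK_nat | apply: inOK_int].
by split; apply: inOKD => //; last apply: inOKN; apply: inOK_sqrt.
Qed.

Lemma cm8_twist_elliptic : elliptic_over m (cm8_twist d).
Proof.
have [[Kd _] _] := twist_OK; have K0 := inK_nat m 0.
split; first by split=> //=; apply: inKM; [apply: inK_nat | | apply: inK_nat | apply: inKX].
by rewrite disc_cm8_twist; apply/eqP; rewrite mulf_neq0 ?expf_neq0 ?d_neq0 ?pnatr_eq0.
Qed.

Section Local.
Variable P : algC -> Prop.
Hypothesis Pprime : prime_ideal_OK m P.

(** The given model already works: its discriminant 2^9 d^6 is a product of elements outside the
    prime ideal. *)
Lemma good_reduction_odd_notd : ~ P 2%:R -> ~ P d -> good_reduction_at m P (cm8_twist d).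
Proof.
move=> N2 Nd; have [Od _] := twist_OK; have [O0 O2] := (inOK_nat m 0, inOK_nat m 2).
have [Kt _] := cm8_twist_elliptic.
have O29 : inOK m (2%:R ^+ 9) by apply: inOKX.
have Od6 : inOK m (d ^+ 6) by apply: inOKX.
exists (cm8_twist d); split=> //.
- have := @K_isomorphic_scale m (cm8_twist d) 1 (inK_nat m 1) (elimN eqP (oner_neq0 _)).
  by rewrite !expr1n !divr1.
- by split=> /=; apply: (P_integral_OK Pprime) => //; apply: inOKM; [apply: inOK_nat | | | apply: inOKX].
- rewrite disc_cm8_twist; apply: (P_unit_OK Pprime) => //.
    exact: inOKM.
  by apply: (prime_ideal_notM Pprime) => //; apply: (prime_ideal_notX Pprime).
Qed.

(* Scaling by [b] is legitimate because [d / b ^+ 2 = - 2 / d'] is a unit at [P]. *)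
Lemma good_reduction_odd_notd' : ~ P 2%:R -> ~ P d' -> good_reduction_at m P (cm8_twist d).
Proof.
move=> N2 Nd'; have [Od Od'] := twist_OK; have [O0 O2] := (inOK_nat m 0, inOK_nat m 2).
have db : d / b%:~R ^+ 2 = - 2%:R / d'.
  apply/eqP; rewrite eqr_div ?expf_neq0 ?b_neq0 ?d'_neq0 //.
  by rewrite twist_norm.
have O2n n : inOK m (2%:R ^+ n) by apply: inOKX.
have Od'n n : inOK m (d' ^+ n) by apply: inOKX.
have ON2n n : inOK m (- 2%:R ^+ n) by apply: inOKN.
have N2n n : ~ P (2%:R ^+ n) by apply: (prime_ideal_notX Pprime).
have Nd'n n : ~ P (d' ^+ n) by apply: (prime_ideal_notX Pprime).
have Kb n : inK m (b%:~R ^+ n)^-1 by rewrite -rmorphXn; apply: inK_intV.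
eexists; split; first by apply: (@K_isomorphic_scale _ _ b%:~R); [apply: inK_int | exact/eqP/b_neq0].
- have [[K1 K2 K3 K4 K6] _] := cm8_twist_elliptic.
  by split; rewrite /= ?mul0r //; apply: inKM.
- split=> /=; rewrite ?mul0r; try by apply: (P_integral_OK Pprime).
  + have -> : 4%:R * d / b%:~R ^+ 2 = - 2%:R ^+ 3 / d' by rewrite -mulrA db; ring.
    exact: (P_integral_div Pprime).
  + have -> : 2%:R * d ^+ 2 / b%:~R ^+ 4 = 2%:R ^+ 3 / d' ^+ 2.
      transitivity (2%:R * (d / b%:~R ^+ 2) ^+ 2); last by rewrite db; field; rewrite d'_neq0.
      by field; rewrite b_neq0.
    exact: (P_integral_div Pprime).
- set D := disc _; have -> : D = 2%:R ^+ 15 / d' ^+ 6.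
    rewrite /D; transitivity (2%:R ^+ 9 * (d / b%:~R ^+ 2) ^+ 6); last by rewrite db; field; rewrite d'_neq0.
    by rewrite /disc /b2 /b4 /b6 /b8 /=; field; rewrite b_neq0.
  split; last split.
  + by apply/eqP; rewrite mulf_neq0 ?invr_neq0 ?expf_neq0 ?d'_neq0 ?pnatr_eq0.
  + exact: (P_integral_div Pprime).
  + by rewrite invf_div; apply: (P_integral_div Pprime).
Qed.

(* [a = 3] mod 4 is needed here: the coefficient a6 of the new model contains [(a + 1) / 4 * pi]. *)
Lemma good_reduction_even : P 2%:R -> good_reduction_at m P (cm8_twist d).
Proof.
move=> P2; have O2 := inOK_nat m 2.
(* As [b] is odd, b^2 = 8 h + 1; this makes the divisions by powers of 2 in the new coefficients
   exact. *)
have [h hl] : exists h, l ^+ 2 + l = 2 * h.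
  by have [h [lh|lh]] := int_parity l; [exists (2 * h ^+ 2 + h) | exists (2 * h ^+ 2 + 3 * h + 1)]; rewrite lh; ring.
have {}hl : l%:~R ^+ 2 + l%:~R = 2%:R * h%:~R :> algC.
  by rewrite -rmorphXn -rmorphD hl rmorphM.
(* The coefficients are forced by the substitution x = 4 x' + 2, y = 8 y' + 4 pi x' + 4 a, once pi^2
   is replaced by 16 h + 2 + 4 a^2. In particular [c6] is (a + 1)^2 / 4 + h. *)
pose c2 : int := 2 * a - a ^+ 2 + 1 - 4 * h.
pose c4 : int := a ^+ 2 + 2 * a + 2 * h + 1.
pose c6 : int := 4 * k ^+ 2 + 8 * k + 4 + h.
pose E' := Weq pi (c2%:~R + pi) a%:~R (c4%:~R + pi) (c6%:~R + (k + 1)%:~R * pi).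
have Opi : inOK m pi := inOK_sqrt m.
have OE' : coeffs_in (inOK m) E'.
  by split=> //=; try apply: inOKD => //; try apply: inOKM => //; apply: inOK_int.
(* [D] is d^2 / 2 expanded by [sqr_pi], which makes its integrality visible; [D'] is its
   conjugate. *)
pose D : algC := 4%:R * a%:~R ^+ 2 + b%:~R ^+ 2 + 2%:R * a%:~R * pi.
pose D' : algC := 4%:R * a%:~R ^+ 2 + b%:~R ^+ 2 - 2%:R * a%:~R * pi.
have DD' : D * D' = b%:~R ^+ 4.
  have -> : D * D' = (4%:R * a%:~R ^+ 2 + b%:~R ^+ 2) ^+ 2 - 4%:R * a%:~R ^+ 2 * pi ^+ 2 by rewrite /D /D'; ring.
  by rewrite sqr_pi; ring.
have OD : inOK m D /\ inOK m D'.
  have O1 : inOK m (4%:R * a%:~R ^+ 2 + b%:~R ^+ 2).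
    by apply: inOKD; [apply: inOKM; [apply: inOK_nat|]|]; apply: inOKX; apply: inOK_int.
  have O3 : inOK m (2%:R * a%:~R * pi).
    by apply: inOKM => //; apply: inOKM => //; apply: inOK_int.
  by split; apply: inOKD => //; apply: inOKN.
have bk : b%:~R = 2%:R * l%:~R + 1 :> algC by rewrite /b rmorphD rmorphM.
have ak : a%:~R = 4%:R * k%:~R + 3%:R :> algC by rewrite /a rmorphD rmorphM.
have c2E : c2%:~R = 2%:R * a%:~R - a%:~R ^+ 2 + 1 - 4%:R * h%:~R :> algC.
  by rewrite /c2 !(rmorphD, rmorphN, rmorphM, rmorphXn).
have c4E : c4%:~R = a%:~R ^+ 2 + 2%:R * a%:~R + 2%:R * h%:~R + 1 :> algC.
  by rewrite /c4 !(rmorphD, rmorphN, rmorphM, rmorphXn).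
have c6E : c6%:~R = 4%:R * k%:~R ^+ 2 + 8%:R * k%:~R + 4%:R + h%:~R :> algC.
  by rewrite /c6 !(rmorphD, rmorphN, rmorphM, rmorphXn).
have q2 : pi ^+ 2 = 2%:R * (4%:R * (2%:R * h%:~R) + 1 + 2%:R * a%:~R ^+ 2).
  by rewrite sqr_pi bk -hl; ring.
have d2 : d ^+ 2 = 4%:R * a%:~R ^+ 2 + 4%:R * a%:~R * pi + pi ^+ 2 by rewrite /d; ring.
have chg : weq_change 2%:R 2%:R pi (4%:R * a%:~R) (cm8_twist d) E'.
  split; rewrite /E' /cm8_twist /= ?d2 ?q2 ?c2E ?c4E ?c6E; try by rewrite /d; ring.
  by rewrite rmorphD /= /d ak; ring.
have iso : K_isomorphic m (cm8_twist d) E'.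
  exists 2%:R, 2%:R, pi, (4%:R * a%:~R); split=> //; last by apply/eqP; rewrite pnatr_eq0.
  split; try exact: inK_nat; first exact: inK_sqrt.
  by apply: inKM; [apply: inK_nat | apply: inK_int].
have discE : disc E' = D ^+ 3.
  have /mulfI : 2%:R ^+ 12 != 0 :> algC by rewrite expf_neq0 ?pnatr_eq0.
  apply; rewrite (disc_change chg) disc_cm8_twist.
  have -> : d ^+ 6 = (2%:R * D) ^+ 3.
    rewrite -[6%N]/(2 * 3)%N exprM; congr (_ ^+ 3).
    by rewrite d2 sqr_pi /D; ring.
  by ring.
exists E'; split=> //.
- by case: OE' => [[? _] [? _] [? _] [? _] [? _]].
- by case: OE' => *; split; apply: (P_integral_OK Pprime).
- have [OD1 OD2] := OD; rewrite discE; apply: (P_unit_OK Pprime) => //; first exact: inOKX.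
  apply: (prime_ideal_notX Pprime) => // PD.
  have : P (b%:~R ^+ 4) by rewrite -DD' mulrC; case: Pprime => _ _ _ PM _; apply: PM.
  by apply: (prime_ideal_notX Pprime) => //; [apply: inOK_int | apply: (prime_ideal_odd Pprime)].
Qed.

(** Otherwise the prime would contain d + d' = 4 a and -d d' = 2 b^2, hence both [a] and [b] as it
    does not contain 2, and so 1 by the Bezout relation [uv]. *)
Lemma prime_ideal_coprime_conj : ~ P 2%:R -> P d -> ~ P d'.
Proof.
move=> N2 Pd Pd'; have [Od Od'] := twist_OK.
have [_ _ PD PM _] := Pprime.
have notP2M x : inOK m x -> P (2%:R * x) -> P x.
  by move=> Ox /(prime_idealM Pprime (inOK_nat m 2) Ox)[].
have Oa := inOK_int m a; have Ob := inOK_int m b.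
have Pa : P a%:~R.
  apply: (notP2M _) => //; apply: (notP2M _); first by apply: inOKM => //; apply: inOK_nat.
  have -> : 2%:R * (2%:R * a%:~R) = d + d' by rewrite /d /d'; ring.
  exact: PD.
have Pb : P b%:~R.
  suff : P (b%:~R ^+ 2) by move=> /(prime_idealM Pprime Ob Ob)[].
  apply: (notP2M _); first exact: inOKX.
  have -> : 2%:R * b%:~R ^+ 2 = - d * d' by rewrite mulNr twist_norm; ring.
  by apply: PM => //; apply: inOKN.
apply: (prime_ideal_not1 Pprime).
have -> : 1 = u%:~R * a%:~R + v%:~R * b%:~R :> algC by rewrite -!rmorphM -rmorphD uv.
by apply: PD; apply: PM => //; apply: inOK_int.
Qed.

Lemma cm8_twist_good : good_reduction_at m P (cm8_twist d).
Proof.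
have [P2|N2] := classic (P 2%:R); first exact: good_reduction_even.
have [Pd|Nd] := classic (P d); last exact: good_reduction_odd_notd.
by apply: good_reduction_odd_notd' => //; apply: prime_ideal_coprime_conj.
Qed.
End Local.
End GoodTwist.

Theorem theorem1p3 (qs : seq nat) :
  uniq qs ->
  all prime qs ->
  all (fun p => (p %% 8 == 1)%N || (p %% 8 == 3)%N) qs ->
  ((\prod_(p <- qs) p) %% 8 = 3)%N ->
  exists E : weq,
    [/\ elliptic_over (2 * \prod_(p <- qs) p)%N E,
        everywhere_good (2 * \prod_(p <- qs) p)%N E
      & jinv E = 20%:R ^+ 3].
Proof.
move=> uqs pqs qs8 q8.
have [k [l [u [v [q_eq uv]]]]] := prod_eq_sq2sq_normalized uqs pqs qs8 q8.
set m := (2 * _)%N.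
have m_eq : m%:Z = 2 * ((2 * l + 1) ^+ 2 + 2 * (4 * k + 3) ^+ 2) by rewrite -q_eq.
exists (cm8_twist (2%:R * (4 * k + 3)%:~R + sqrtC m%:R)); split.
- exact: (@cm8_twist_elliptic m k l m_eq).
- by move=> P Pprime; apply: (@cm8_twist_good m k l u v m_eq uv P Pprime).
- by apply: jinv_cm8_twist; apply/eqP; apply: (@d_neq0 m k l m_eq).
Qed.
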